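(* There exists a finitely branching countable MDP $\mathcal M$ with an initial state $s_0$ such that (i) $\mathtt{val}_{\mathcal M,\mathtt{Transience}}(s)=1$ for all controlled states $s$ of $\mathcal M$; and (ii) there does not exist any optimal strategy from $s_0$, i.e. there is no strategy $\sigma$ with $\mathcal P_{\mathcal M,s_0,\sigma}(\mathtt{Transience})=1$.
   Context: MDPs: an MDP is a tuple $\mathcal M=(S,S_\Box,S_\bigcirc,\longrightarrow,P)$ where $S$ is a countable set of states partitioned into controlled states $S_\Box$ and random states $S_\bigcirc$, $\longrightarrow\subseteq S\times S$ is a transition relation in which every state has at least one successor, and $P$ assigns to each random state $s$ a probability distribution $P(s)$ on its successors. It is finitely branching if every state has finitely many successors. A run is an infinite sequence $s_0s_1\cdots$ with $s_i\longrightarrow s_{i+1}$ for all $i$. A strategy is a function $\sigma:S^*S_\Box\to\mathcal D(S)$ (where $\mathcal D(S)$ is the set of probability distributions on $S$) assigning to each finite sequence $\rho s$ ending in a controlled state $s$ a distribution over successors of $s$. A strategy $\sigma$ and initial state $s_0$ induce the usual probability measure $\mathcal P_{\mathcal M,s_0,\sigma}$ on infinite sequences starting in $s_0$ (at random states the successor is drawn according to $P$). For a measurable objective $\varphi$ (a set of runs), $\mathtt{val}_{\mathcal M,\varphi}(s)=\sup_\sigma \mathcal P_{\mathcal M,s,\sigma}(\varphi)$, the supremum over all strategies. $\mathtt{Transience}$ is the set of runs that visit no state infinitely often. *)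

(* Defs.v *)
From HB Require Import structures.
From mathcomp Require Import all_boot all_order all_algebra.
From mathcomp Require Import all_classical all_reals all_analysis.

Set Implicit Arguments.
Unset Strict Implicit.
Unset Printing Implicit Defensive.

Import Order.TTheory GRing.Theory Num.Theory.
Local Open Scope classical_set_scope.
Local Open Scope ring_scope.

Definition distribution_on (R : realType) (T : countType) (A : pred T)
    (p : T -> R) : Prop :=
  [/\ forall t, 0 <= p t,
      (\esum_(t in [set: T]) (p t)%:E = 1)%E
    & forall t, ~~ A t -> p t = 0].

(* The random states are those that are not controlled. The values of [rand]
   at controlled states are irrelevant. *)
Record mdp (R : realType) := MDP {
  state :> countType;
  controlled : pred state;
  step : rel state;
  step_total : forall s, exists t, step s t;
  rand : state -> state -> R;
  rand_distribution :
    forall s, ~~ controlled s -> distribution_on (step s) (rand s) }.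

Definition finitely_branching (R : realType) (M : mdp R) : Prop :=
  forall s : M, finite_set [set t | step s t].

(* [decide sigma rho s] is the distribution chosen after the finite sequence
   [rho s]; it is only constrained, and only used, when [s] is controlled. *)
Record strategy (R : realType) (M : mdp R) := Strategy {
  decide : seq M -> M -> M -> R;
  decide_distribution : forall rho s,
    controlled s -> distribution_on (step s) (decide rho s) }.

Definition next_prob (R : realType) (M : mdp R) (sigma : strategy M)
    (rho : seq M) (s : M) : M -> R :=
  if controlled s then decide sigma rho s else rand s.

(* The probability that, after the history [rho s], the next [size w] states
   are the ones listed in [w]. *)
Fixpoint word_prob (R : realType) (M : mdp R) (sigma : strategy M)
    (rho : seq M) (s : M) (w : seq M) : R :=
  if w is t :: w' then
    next_prob sigma rho s t * word_prob sigma (rcons rho s) t w'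
  else 1.

(* All infinite state_seq of states, not just the runs. The parameter [s0] only
   serves to make the type pointed, as measurable types have to be. *)
Definition state_seq (R : realType) (M : mdp R) (s0 : M) : Type := nat -> M.
HB.instance Definition _ (R : realType) (M : mdp R) (s0 : M) :=
  Choice.copy (state_seq s0) (nat -> M).
HB.instance Definition _ (R : realType) (M : mdp R) (s0 : M) :=
  isPointed.Build (state_seq s0) (fun=> s0).

Definition cylinder (T : Type) (w : seq T) : set (nat -> T) :=
  [set r | mkseq r (size w) = w].

Definition cylinders (R : realType) (M : mdp R) (s0 : M) :
  set (set (state_seq s0)) := range (@cylinder M).
Arguments cylinders {R M} s0.

Definition seq_space (R : realType) (M : mdp R) (s0 : M) :=
  g_sigma_algebraType (cylinders s0).

Definition is_induced (R : realType) (M : mdp R) (s0 : M) (sigma : strategy M)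
    (mu : probability (seq_space s0) R) : Prop :=
  forall w, mu (cylinder (s0 :: w)) = (word_prob sigma [::] s0 w)%:E.

(* The measure selected by [get] exists and is unique: see [inducedP] and
   [induced_unique]. *)
Definition Pr (R : realType) (M : mdp R) (s0 : M) (sigma : strategy M) :
  probability (seq_space s0) R := get (@is_induced R M s0 sigma).
Arguments Pr {R M} s0 sigma.

Definition value (R : realType) (M : mdp R) (phi : set (nat -> M)) (s : M) :
  \bar R := ereal_sup [set Pr s sigma phi | sigma in [set: strategy M]].

Definition optimal (R : realType) (M : mdp R) (phi : set (nat -> M)) (s : M)
    (sigma : strategy M) : Prop := Pr s sigma phi = value phi s.

Definition run (R : realType) (M : mdp R) : set (nat -> M) :=
  [set r | forall i, step (r i) (r i.+1)].

Definition Transience (R : realType) (M : mdp R) : set (nat -> M) :=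
  [set r | run r /\ forall s, finite_set [set i | r i = s]].
Arguments Transience {R} M.

Section Quantile.
Context (R : realType) (T : countType).
Implicit Types (p : T -> R) (A : pred T).

Definition pickled_pmf p (i : nat) : R := oapp p 0 (pickle_inv i).

Definition cumulative p n : R := \sum_(i < n) pickled_pmf p i.

Lemma cumulativeS p t :
  cumulative p (pickle t).+1 = cumulative p (pickle t) + p t.
Proof. by rewrite /cumulative big_ord_recr/= {2}/pickled_pmf pickleK_inv. Qed.

Section Pmf.
Context (A : pred T) (p : T -> R).
Context (dp : distribution_on A p).

Lemma pickled_pmf_ge0 i : 0 <= pickled_pmf p i.
Proof. by case: dp => p0 _ _; rewrite /pickled_pmf; case: pickle_inv => //=. Qed.

Lemma cumulative_ge0 n : 0 <= cumulative p n.
Proof. by apply: sumr_ge0 => i _; exact: pickled_pmf_ge0. Qed.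

Lemma cumulative_le : {homo cumulative p : m n / (m <= n)%N >-> m <= n}.
Proof.
apply: homo_leq => [x|y x z|n]; [by [] | exact: le_trans |].
by rewrite /cumulative big_ord_recr lerDl pickled_pmf_ge0.
Qed.

Lemma nneseries_pickled_pmf : (\sum_(0 <= i <oo) (pickled_pmf p i)%:E = 1)%E.
Proof.
case: dp => p0 p1 _.
rewrite nneseries_esumT; last by move=> i; rewrite lee_fin pickled_pmf_ge0.
rewrite -p1 (eq_esum (b := fun i => (pickled_pmf p (pickle i))%:E)); last first.
  by move=> t _; rewrite /pickled_pmf pickleK_inv.
rewrite -(@esum_image _ _ _ _ pickle (fun i => (pickled_pmf p i)%:E)); last first.
  by move=> x y _ _ /(pcan_inj pickleK).
rewrite [RHS]esum_mkcond [LHS]esum_mkcond; apply: eq_esum => i _.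
rewrite in_setT; case: ifPn => // /negP iNr.
rewrite /pickled_pmf; case E : (pickle_inv i) => [t|] //=.
exfalso; apply: iNr; apply/mem_set; exists t => //.
by have := @pickle_invK T i; rewrite E.
Qed.

Lemma cumulative_le1 n : cumulative p n <= 1.
Proof.
rewrite -lee_fin -nneseries_pickled_pmf /cumulative -sumEFin.
rewrite -(big_mkord xpredT (fun i => (pickled_pmf p i)%:E)).
by apply: nneseries_lim_ge => i _ _; rewrite lee_fin pickled_pmf_ge0.
Qed.

Lemma cumulative_gt v : v < 1 -> exists n, v < cumulative p n.
Proof.
move=> v1; apply: contrapT => /forallNP h.
suff : (1 <= v%:E)%E by rewrite lee_fin leNgt v1.
rewrite -nneseries_pickled_pmf; apply: lime_le.
  by apply: is_cvg_nneseries => i _ _; rewrite lee_fin pickled_pmf_ge0.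
apply: nearW => n /=.
by rewrite big_mkord sumEFin lee_fin leNgt; exact/negP/h.
Qed.

Definition quantile_at v : set T :=
  [set t | cumulative p (pickle t) <= v < cumulative p (pickle t) + p t].

Lemma quantile_exists v : 0 <= v < 1 -> exists t, quantile_at v t.
Proof.
move=> /andP[v0 v1]; have h := cumulative_gt v1.
case: (ex_minnP h) => -[|m] hm mmin.
  by move: hm; rewrite /cumulative big_ord0 ltNge v0.
have le_mv : cumulative p m <= v.
  by rewrite leNgt; apply/negP => /mmin; rewrite ltnn.
have : pickled_pmf p m != 0.
  by apply: contraTneq hm => q0; rewrite /cumulative big_ord_recr/= q0 addr0 -leNgt.
rewrite /pickled_pmf; case E : (pickle_inv m) => [t|]/=; last by rewrite eqxx.
have tm : pickle t = m by have := @pickle_invK T m; rewrite E.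
by move=> _; exists t; rewrite /quantile_at/= -cumulativeS tm le_mv.
Qed.

Lemma quantile_unique v t t' : quantile_at v t -> quantile_at v t' -> t = t'.
Proof.
rewrite /quantile_at/= -!cumulativeS => /andP[a b] /andP[c d].
apply: (pcan_inj pickleK); apply/eqP; rewrite eqn_leq; apply/andP; split;
  rewrite leqNgt; apply/negP => /cumulative_le lt.
  by have := lt_le_trans d (le_trans lt a); rewrite ltxx.
by have := lt_le_trans b (le_trans lt c); rewrite ltxx.
Qed.
End Pmf.
End Quantile.

(* The process is realised on [0, 1) with the Lebesgue measure, every step
   using the current point as the argument of a quantile function and then
   rescaling to [0, 1) the interval of the points that yield the same state. *)
Section Realisation.
Context (R : realType) (M : mdp R) (s0 : M) (sigma : strategy M).
Let K := next_prob sigma.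

Lemma next_prob_distribution rho s : distribution_on (step s) (K rho s).
Proof.
rewrite /K /next_prob; case: ifPn => c.
  exact: decide_distribution.
exact: rand_distribution.
Qed.
Let dK := next_prob_distribution.

Let next rho s v : M := xget s (quantile_at (K rho s) v).

Let advance (x : R * seq M * M) : R * seq M * M :=
  let: (v, rho, s) := x in let t := next rho s v in
  ((v - cumulative (K rho s) (pickle t)) / K rho s t, rcons rho s, t).

Let path x n : M := (iter n advance x).2.

Fixpoint word_left rho s w : R :=
  if w is t :: w' then
    cumulative (K rho s) (pickle t) + K rho s t * word_left (rcons rho s) t w'
  else 0.

Lemma next_prob_ge0 rho s t : 0 <= K rho s t.
Proof. by case: (dK rho s). Qed.

Lemma word_prob_ge0 rho s w : 0 <= word_prob sigma rho s w.
Proof. by elim: w rho s => //= t w IH rho s; rewrite mulr_ge0 ?next_prob_ge0. Qed.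

Lemma word_left_bound rho s w : 0 <= word_left rho s w /\
  word_left rho s w + word_prob sigma rho s w <= 1.
Proof.
elim: w rho s => [|t w IH] rho s /=; first by rewrite add0r.
have [l0 l1] := IH (rcons rho s) t.
have K0 := next_prob_ge0 rho s t.
split; first by rewrite addr_ge0 ?(cumulative_ge0 (dK _ _)) ?mulr_ge0.
rewrite -addrA -mulrDr; apply: le_trans (cumulative_le1 (dK rho s) (pickle t).+1).
by rewrite cumulativeS lerD2l ler_piMr.
Qed.

Lemma path_word v rho s w : 0 <= v < 1 ->
  mkseq (path (v, rho, s)) (size w).+1 = s :: w <->
  word_left rho s w <= v < word_left rho s w + word_prob sigma rho s w.
Proof.
elim: w v rho s => [|t w IH] v rho s v01 /=; first by rewrite add0r.
have qn : quantile_at (K rho s) v (next rho s v).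
  apply: xgetPex; exact: (quantile_exists (dK _ _)).
have E : mkseq (path (v, rho, s)) (size w).+2 =
    s :: mkseq (path (advance (v, rho, s))) (size w).+1.
  rewrite /mkseq -[iota 0 _.+2]/(0%N :: iota 1 (size w).+1) /=.
  congr (_ :: _ :: _); rewrite (iotaDl 1 1) -map_comp; apply: eq_map => n /=.
  by rewrite /path add1n iterSr.
rewrite E.
have [l0 l1] := word_left_bound (rcons rho s) t w.
set c := cumulative _ _; set l := word_left _ _ _ in l0 l1 *.
set pw := word_prob _ _ _ _ in l0 l1 *.
have pw0 : 0 <= pw by exact: word_prob_ge0.
have K0 := next_prob_ge0 rho s t.
have kt : c + K rho s t * l <= v < c + K rho s t * l + K rho s t * pw ->
    quantile_at (K rho s) v t.
  rewrite /quantile_at/= => /andP[h1 h2]; apply/andP; split.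
    by rewrite (le_trans _ h1)// lerDl mulr_ge0.
  by rewrite (lt_le_trans h2)// -addrA -mulrDr lerD2l ler_piMr.
have main : quantile_at (K rho s) v t -> next rho s v = t ->
    (mkseq (path (advance (v, rho, s))) (size w).+1 = t :: w <->
    c + K rho s t * l <= v < c + K rho s t * l + K rho s t * pw).
  rewrite /quantile_at/= => /andP[h1 h2] ->.
  have Kp : 0 < K rho s t by rewrite -(ltrD2l c) addr0 (le_lt_trans h1).
  rewrite IH; last by rewrite divr_ge0 ?subr_ge0//= ltr_pdivrMr// mul1r ltrBlDl.
  rewrite -/l -/pw ler_pdivlMr// ltr_pdivrMr// -/c.
  by rewrite lerBrDl ltrBlDl mulrDl [l * _]mulrC [pw * _]mulrC addrA.
split=> [h|h].
  have {}h : mkseq (path (advance (v, rho, s))) (size w).+1 = t :: w.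
    by have := congr1 behead h.
  have nt : next rho s v = t by move: h; rewrite /mkseq /= => -[].
  have q : quantile_at (K rho s) v t by rewrite -nt.
  exact/(main q nt).
have nt : next rho s v = t by exact: (quantile_unique (dK _ _) qn (kt h)).
by congr (_ :: _); apply/(main (kt h) nt).
Qed.

Let word w : set (measurableTypeR R) := [set` `[word_left [::] s0 w,
  word_left [::] s0 w + word_prob sigma [::] s0 w[%R].

Let I01 : set (measurableTypeR R) := [set` `[0, 1[%R].

Let X (v : measurableTypeR R) : seq_space s0 :=
  if v \in I01 then path (v, [::], s0) else fun=> s0.

Let I01E v : I01 v = (0 <= v < 1) :> Prop.
Proof. by rewrite /I01 /= in_itv. Qed.

Let X_word w : X @^-1` (cylinder (s0 :: w)) `&` I01 = word w.
Proof.
apply/seteqP; split=> [v [] | v].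
  rewrite /preimage/= /cylinder/= /X => + Iv; rewrite mem_set// /word/= in_itv/=.
  by move=> /path_word; apply; rewrite -I01E.
rewrite /word/= in_itv/= => h.
have v01 : 0 <= v < 1.
  have [l0 l1] := word_left_bound [::] s0 w.
  by case/andP: h => h1 h2; rewrite (le_trans l0)//= (lt_le_trans h2).
split; last by rewrite I01E.
by rewrite /cylinder /= /X mem_set ?I01E//; exact/path_word.
Qed.

Let X0 v : X v 0 = s0.
Proof. by rewrite /X; case: ifP. Qed.

Let measurable_I01 : measurable I01. Proof. exact: measurable_itv. Qed.

Let measurable_X : measurable_fun [set: measurableTypeR R] X.
Proof.
refine (@measurability _ _ _ _ setT X (cylinders s0) _ _) => //.
move=> _ [_ [[|s w] _ <-] <-]; rewrite setTI.
  by rewrite (_ : _ @^-1` _ = setT) //; apply/seteqP.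
have [->|ss0] := eqVneq s s0; last first.
  rewrite (_ : _ @^-1` _ = set0) //; apply/seteqP; split=> // v /=.
  by rewrite /cylinder /= /mkseq /= X0 => -[/esym/eqP]; rewrite (negbTE ss0).
have -> : X @^-1` cylinder (s0 :: w) = word w `|`
    (~` I01 `&` [set v | cylinder (s0 :: w) (fun=> s0)]).
  rewrite -X_word; apply/seteqP; split=> v /=.
    move=> h; have [Iv|nIv] := pselect (I01 v); [by left|right; split=> //].
    by move: h; rewrite /X memNset.
  by case=> [[]//|[nIv h]]; rewrite /X memNset.
apply: measurableU; first exact: measurable_itv.
apply: measurableI; first exact: measurableC.
have [h|h] := pselect (cylinder (s0 :: w) (fun=> s0)).
  by rewrite (_ : [set _ | _] = setT)//; apply/seteqP; split.
by rewrite (_ : [set _ | _] = set0)//; apply/seteqP; split=> v //= /h.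
Qed.

Let nu : {measure set (measurableTypeR R) -> \bar R} :=
  mrestr (@lebesgue_measure R) measurable_I01.

Definition realised_measure : set (seq_space s0) -> \bar R :=
  pushforward nu X.

Let realised_measure0 : realised_measure set0 = 0%E.
Proof. by rewrite /realised_measure /pushforward preimage_set0 measure0. Qed.

Let realised_measure_ge0 A : (0 <= realised_measure A)%E.
Proof. exact: measure_ge0. Qed.

Let realised_measure_sigma_additive : semi_sigma_additive realised_measure.
Proof.
move=> F mF tF mUF; rewrite /realised_measure /pushforward preimage_bigcup.
apply: measure_semi_sigma_additive.
- by move=> n; rewrite -[X in measurable X]setTI; exact: measurable_X.
- apply/trivIsetP => /= i j _ _ ij; rewrite -preimage_setI.
  by move/trivIsetP : tF => /(_ _ _ _ _ ij) ->//; rewrite preimage_set0.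
- by rewrite -preimage_bigcup -[X in measurable X]setTI; exact: measurable_X.
Qed.

HB.instance Definition _ := isMeasure.Build _ _ _ realised_measure
  realised_measure0 realised_measure_ge0 realised_measure_sigma_additive.

Let realised_measure_cylinder w :
  realised_measure (cylinder (s0 :: w)) = (word_prob sigma [::] s0 w)%:E.
Proof.
have -> : realised_measure (cylinder (s0 :: w)) = lebesgue_measure (word w).
  by rewrite -X_word.
rewrite /word lebesgue_measure_itv/= lte_fin ltrDl.
have := word_prob_ge0 [::] s0 w; rewrite le_eqVlt => /predU1P[<-|->].
  by rewrite ltxx.
by rewrite -EFinB addrAC subrr add0r.
Qed.

Let realised_measureT : realised_measure [set: seq_space s0] = 1%E.
Proof.
have -> : realised_measure [set: seq_space s0] = lebesgue_measure I01.
  by rewrite -[I01]setTI.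
by rewrite lebesgue_measure_itv/= lte_fin ltr01 oppr0 adde0.
Qed.

HB.instance Definition _ :=
  Measure_isProbability.Build _ _ _ realised_measure realised_measureT.

Theorem inducedP : is_induced sigma (Pr s0 sigma).
Proof.
apply: getPex; exists (realised_measure : probability (seq_space s0) R).
exact: realised_measure_cylinder.
Qed.

Theorem induced_unique (mu : probability (seq_space s0) R) :
  is_induced sigma mu ->
  forall A : set (seq_space s0), measurable A -> mu A = Pr s0 sigma A.
Proof.
move=> imu; have iPr := inducedP.
have mcyl w : measurable (cylinder w : set (seq_space s0)).
  by apply: sub_sigma_algebra; exists w.
have null (P : probability (seq_space s0) R) s w :
    is_induced sigma P -> s != s0 -> P (cylinder (s :: w)) = 0%E.
  move=> iP ss0; apply/eqP; rewrite eq_le measure_ge0 andbT.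
  have -> : 0%E = P (~` cylinder [:: s0]).
    by rewrite probability_setC// iP/= subee.
  apply: le_measure; rewrite ?inE//; first exact: measurableC.
  move=> r; rewrite /cylinder/= /mkseq/= => -[r0 _] [r0'].
  by move: ss0; rewrite -r0 r0' eqxx.
have gen (A : set (seq_space s0)) : measurable A -> <<s cylinders s0 `|` [set set0]>> A.
  by apply: sub_sigma_algebra2; left.
move=> A /gen; apply: (@g_sigma_algebra_measure_unique _ R (seq_space s0)
    (cylinders s0 `|` [set set0]) _ (fun=> setT)).
- by move=> _ [[w _ <-]|->]; [exact: mcyl|exact: measurable0].
- by move=> _; left; exists [::] => //; exact/seteqP.
- by apply/seteqP; split=> // x _; exists 0%N.
- move=> B C [[u _ <-]|->]; last by rewrite set0I; right.
  case=> [[v _ <-]|->]; last by rewrite setI0; right.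
  wlog uv : u v / (size u <= size v)%N.
    by move=> h; have /orP[/h//|/h] := leq_total (size u) (size v); rewrite setIC.
  have tk (r : nat -> M) : take (size u) (mkseq r (size v)) = mkseq r (size u).
    by rewrite /mkseq -map_take take_iota (minn_idPl uv).
  have [uE|nuE] := eqVneq (take (size u) v) u; [left; exists v => //|right].
    apply/seteqP; split=> [r rv|r []//]; split=> //.
    by move: (tk r); rewrite rv uE.
  apply/seteqP; split=> // r [ru rv].
  by move: (tk r); rewrite rv ru => /eqP; rewrite (negbTE nuE).
- move=> _ [[[|s w] _ <-]|->]; last by rewrite !measure0.
    have -> : cylinder [::] = [set: seq_space s0] by exact/seteqP.
    by transitivity (1%E : \bar R); [|symmetry]; exact: probability_setT.
  have [->|ss0] := eqVneq s s0; last first.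
    by transitivity (0%E : \bar R); [|symmetry]; exact: null.
  by transitivity ((word_prob sigma [::] s0 w)%:E);
    [exact: imu|symmetry; exact: iPr].
- by move=> _; apply: le_lt_trans (ltry 1); exact: probability_le1.
Qed.
End Realisation.

(* Main.v *)
(** The gambler climbs a ladder whose rungs are the controlled states. At rung
    [i] they either gamble, which leads to rung [i + 1] or back to rung [0] with
    probability 1/2 each, or exit, which fails with probability [1 / (i + 1)]
    and otherwise leads to a transient ray. Exiting at rung [n] and above
    succeeds with probability at least [1 - 1 / (n + 1)], since rung [n] is
    reached almost surely. But a strategy that never exits almost surely returns
    to rung [0] infinitely often: a transient run without exit eventually only
    climbs, and there are countably many such runs, each of probability zero.
    Hence a transient run almost surely exits, and every exit carries a positive
    probability of failure. *)
Require Import Defs.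
From HB Require Import structures.
From mathcomp Require Import all_boot all_order all_algebra.
From mathcomp Require Import all_classical all_reals all_analysis.
From mathcomp Require Import ring lra.

Set Implicit Arguments.
Unset Strict Implicit.
Unset Printing Implicit Defensive.

Import Order.TTheory GRing.Theory Num.Theory.
Local Open Scope classical_set_scope.
Local Open Scope ring_scope.

(** * Cylinders and countable index sets *)

Lemma cylinder_cat (T : Type) (u v : seq T) (r : nat -> T) :
  cylinder (u ++ v) r <->
  cylinder u r /\ mkseq (fun k => r (size u + k)%N) (size v) = v.
Proof.
have E : mkseq r (size (u ++ v)) =
    mkseq r (size u) ++ mkseq (fun k => r (size u + k)%N) (size v).
  rewrite size_cat /mkseq iotaD map_cat add0n; congr (_ ++ _).
  by rewrite -[X in iota X _]addn0 iotaDl -map_comp.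
rewrite /cylinder/= E; split=> [|[-> ->]//].
move=> h; split.
  by have := congr1 (take (size u)) h; rewrite !take_size_cat ?size_mkseq.
by have := congr1 (drop (size u)) h; rewrite !drop_size_cat ?size_mkseq.
Qed.

Lemma cylinder_nth (T : Type) (u : seq T) (r : nat -> T) x0 k :
  cylinder u r -> (k < size u)%N -> r k = nth x0 u k.
Proof. by move=> <- h; rewrite nth_mkseq// -[X in (_ < X)%N](size_mkseq r). Qed.

Lemma finite_nat_bounded (A : set nat) :
  finite_set A <-> exists n, forall i, A i -> (i < n)%N.
Proof.
split=> [/finite_seqP[l ->]|[n nP]]; last exact: sub_finite_set nP (finite_II n).
exists (sumn l).+1 => i; elim: l => //= x l IH; rewrite inE => /predU1P[->|/IH].
  by rewrite ltnS leq_addr.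
by rewrite !ltnS => /leq_trans; apply; exact: leq_addl.
Qed.

Lemma bigcup_unpickle (S : Type) (T : countType) (F : T -> set S) :
  \bigcup_t F t = \bigcup_n oapp F set0 (unpickle n).
Proof.
apply/seteqP; split=> [r [t _ h]|r [n _]].
  by exists (pickle t) => //; rewrite pickleK.
by case: unpickle => //= t h; exists t.
Qed.

(** * Probabilities of finite words *)

Section Word_prob.
Context (R : realType) (M : mdp R) (sigma : strategy M).

Lemma word_prob_le1 rho (s : M) w : word_prob sigma rho s w <= 1.
Proof.
have [l0 l1] := word_left_bound sigma rho s w.
by apply: le_trans l1; rewrite lerDr.
Qed.

Lemma next_prob_le1 rho (s t : M) : next_prob sigma rho s t <= 1.
Proof. by have := word_prob_le1 rho s [:: t]; rewrite /= mulr1. Qed.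

Lemma word_prob_cat rho (s : M) u v : word_prob sigma rho s (u ++ v) =
  word_prob sigma rho s u * word_prob sigma (rho ++ belast s u) (last s u) v.
Proof.
elim: u rho s => [|t u IH] rho s /=; first by rewrite cats0 mul1r.
by rewrite IH mulrA cat_rcons.
Qed.

Lemma word_prob_path rho (s : M) w :
  word_prob sigma rho s w != 0 -> path (@step R M) s w.
Proof.
elim: w rho s => //= t w IH rho s; rewrite mulf_eq0 negb_or => /andP[h /IH ->].
rewrite andbT; apply: contraNT h => st; apply/eqP.
by case: (next_prob_distribution sigma rho s) => _ _ /(_ _ st).
Qed.
End Word_prob.

(** * Measurability of transience *)

Section Events.
Context (R : realType) (M : mdp R) (s0 : M).
Implicit Types w : seq M.

Lemma measurable_cylinder w : measurable (cylinder w : set (seq_space s0)).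
Proof. by apply: sub_sigma_algebra; exists w. Qed.

Lemma measurable_bigcup_count (T : countType) (F : T -> set (seq_space s0)) :
  (forall t, measurable (F t)) -> measurable (\bigcup_t F t).
Proof.
move=> mF; rewrite bigcup_unpickle; apply: bigcupT_measurable => n.
by case: unpickle => [t|] /=; [exact: mF|exact: measurable0].
Qed.

Lemma measurable_at k (s : M) :
  measurable ([set r | r k = s] : set (seq_space s0)).
Proof.
have -> : [set r : seq_space s0 | r k = s] = \bigcup_w
    (if size w == k then cylinder (rcons w s) else set0).
  apply/seteqP; split=> [r /= rk|r [w _]].
    exists (mkseq r k) => //; rewrite size_mkseq eqxx.
    by rewrite /cylinder/= size_rcons size_mkseq mkseqS rk.
  case: eqP => // <- /(@cylinder_nth _ _ _ s (size w)).
  by rewrite size_rcons nth_rcons ltnn eqxx; apply.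
apply: measurable_bigcup_count => w.
by case: ifP => // _; exact: measurable_cylinder.
Qed.

(** The complement is a countable combination of events that fix a single coordinate: some step is
    illegal, or some state occurs at arbitrarily late times. *)
Lemma measurable_Transience : measurable (Transience M : set (seq_space s0)).
Proof.
have -> : (Transience M : set (seq_space s0)) = ~` (
    (\bigcup_k \bigcup_(p : M * M) (if step p.1 p.2 then set0 else
       [set r | r k = p.1] `&` [set r | r k.+1 = p.2])) `|`
    \bigcup_(s : M) \bigcap_n \bigcup_k [set r | r (n + k)%N = s]).
  apply/seteqP; split=> r.
    move=> [rr ft] [[k _ [[s t] _]]/=|[s _ often]].
      by case: ifPn => // /negP st [rs rt]; apply: st; rewrite -rs -rt.
    have /finite_nat_bounded[n nP] := ft s.
    by have [k _ /nP] := often n I; rewrite ltnNge leq_addr.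
  move=> /not_orP[rr often]; split.
    move=> k; apply: contrapT => nst; apply: rr; exists k => //.
    by exists (r k, r k.+1) => //=; case: ifP.
  move=> s; apply/finite_nat_bounded; apply: contrapT => /forallNP h.
  apply: often; exists s => // n _; have /existsNP[k /not_implyP[rk kn]] := h n.
  by exists (k - n)%N => //=; rewrite subnKC// leqNgt; exact/negP.
apply: measurableC; apply: measurableU.
  apply: bigcupT_measurable => k; apply: measurable_bigcup_count => p.
  case: ifP => _; first exact: measurable0.
  by apply: measurableI; exact: measurable_at.
apply: measurable_bigcup_count => s; apply: bigcapT_measurable => n.
by apply: bigcupT_measurable => k; exact: measurable_at.
Qed.

End Events.

(** * Runs that eventually follow a deterministic map *)

Section Tail.
Context (R : realType) (M : mdp R) (s0 : M) (f : M -> M).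
Implicit Types w : seq M.

Definition tail_cylinder w n : set (seq_space s0) :=
  cylinder (s0 :: w ++ traject f (f (last s0 w)) n).

(** This is a singleton: the sequence that reads [s0 :: w] and then iterates [f]. Writing it as a
    decreasing intersection of cylinders makes its measure a limit of word probabilities. *)
Definition tail w : set (seq_space s0) := \bigcap_n tail_cylinder w n.

Lemma tailP w (r : seq_space s0) : tail w r <->
  cylinder (s0 :: w) r /\ forall k, r (size w + k)%N = iter k f (last s0 w).
Proof.
split=> [h|[rw rk] n _].
  have c n : cylinder (s0 :: w) r /\
      mkseq (fun k => r (size (s0 :: w) + k)%N) n = traject f (f (last s0 w)) n.
    have := h n I; rewrite /tail_cylinder -cat_cons => /cylinder_cat.
    by rewrite size_traject.
  have [rw _] := c 0%N; split=> // -[|k].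
    (* Because of the leading [s0], index [size w] is the last letter of [s0 :: w]. *)
    rewrite addn0 (cylinder_nth s0 rw)//= -last_nth//.
  have [_] := c k.+1; rewrite mkseqS trajectSr => /rcons_inj[_].
  by rewrite -iterSr /= addSnnS.
rewrite /tail_cylinder -cat_cons; apply/cylinder_cat; split=> //.
rewrite size_traject; apply: (@eq_from_nth _ s0).
  by rewrite size_mkseq size_traject.
rewrite size_mkseq => i ilt; rewrite nth_mkseq//.
rewrite (set_nth_default (f (last s0 w))) ?size_traject// nth_traject//.
rewrite -iterSr -rk.
by rewrite addSnnS.
Qed.

Lemma measurable_tail w : measurable (tail w).
Proof. by apply: bigcapT_measurable => n; exact: measurable_cylinder. Qed.

(** Continuity of [mu] from above along the decreasing cylinders. *)
Lemma tail_ge (mu : probability (seq_space s0) R) w (a : \bar R) :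
  (forall n, a <= mu (tail_cylinder w n))%E -> (a <= mu (tail w))%E.
Proof.
move=> h; have cv : mu \o tail_cylinder w @ \oo --> mu (tail w).
  apply: nonincreasing_cvg_mu.
  - exact: le_lt_trans (probability_le1 _ (measurable_cylinder _)) (ltry 1).
  - by move=> n; exact: measurable_cylinder.
  - exact: measurable_tail.
  - move=> m n mn; apply/subsetPset => r; rewrite /tail_cylinder -(subnKC mn).
    by rewrite trajectD catA -cat_cons => /cylinder_cat[].
rewrite -(cvg_lim _ cv)//; apply: lime_ge.
  by apply/cvg_ex; exists (mu (tail w)).
by apply: nearW.
Qed.
End Tail.
Arguments tail_cylinder {R M} s0 f w n.
Arguments tail {R M} s0 f w.

(** * Two-point distributions *)

Section Two_point.
Context (R : realType) (T : countType).

(** The sum form also covers [a = b], where it is the Dirac mass; this case gives the forced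
    moves. *)
Definition two_point (q : R) (a b t : T) : R :=
  q * (t == a)%:R + (1 - q) * (t == b)%:R.

Lemma two_pointl q a b : a != b -> two_point q a b a = q.
Proof. by move=> /negbTE ab; rewrite /two_point eqxx ab mulr1 mulr0 addr0. Qed.

Lemma two_pointr q a b : a != b -> two_point q a b b = 1 - q.
Proof.
by rewrite eq_sym => /negbTE ab; rewrite /two_point eqxx ab mulr1 mulr0 add0r.
Qed.

Lemma two_pointxx q a : two_point q a a a = 1.
Proof. by rewrite /two_point eqxx !mulr1 addrC subrK. Qed.

Lemma esum_point (q : R) (a : T) : 0 <= q ->
  (\esum_(t in [set: T]) (q * (t == a)%:R)%:E = q%:E)%E.
Proof.
move=> q0; rewrite (eq_esum (b := fun t => if t \in [set a] then q%:E else 0%E)).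
  by rewrite -(esum_mkcond [set a] (fun=> q%:E)) esum_set1.
by move=> t _; rewrite in_set1; case: eqP; rewrite ?mulr1 ?mulr0.
Qed.

Lemma two_point_distribution (A : pred T) (q : R) (a b : T) :
  0 <= q <= 1 -> A a -> A b -> distribution_on A (two_point q a b).
Proof.
move=> /andP[q0 q1] Aa Ab; have p0 : 0 <= 1 - q by rewrite subr_ge0.
split=> [t||t nA]; rewrite /two_point.
- by rewrite addr_ge0 ?mulr_ge0.
- under eq_esum do rewrite EFinD.
  rewrite esumD ?esum_point//; first by rewrite -EFinD addrC subrK.
  + by move=> t _; rewrite lee_fin mulr_ge0.
  + by move=> t _; rewrite lee_fin mulr_ge0.
- have /negbTE -> : t != a by apply: contraNneq nA => ->.
  have /negbTE -> : t != b by apply: contraNneq nA => ->.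
  by rewrite !mulr0 addr0.
Qed.
End Two_point.

(** * The gambling MDP *)

Inductive position :=
  Ladder of nat | Gamble of nat | Exit of nat | Goal of nat | Sink of nat.

Definition position_code (s : position) : nat * nat :=
  match s with
  | Ladder i => (0, i) | Gamble i => (1, i) | Exit i => (2, i)
  | Goal i => (3, i) | Sink i => (4, i)
  end%N.

Definition position_decode (c : nat * nat) : position :=
  match c.1 with
  | 0 => Ladder c.2 | 1 => Gamble c.2 | 2 => Exit c.2 | 3 => Goal c.2
  | _ => Sink c.2
  end%N.

Lemma position_codeK : cancel position_code position_decode.
Proof. by case. Qed.

HB.instance Definition _ := Countable.copy position (can_type position_codeK).

(** Each state has at most two moves, [up] and [down], which coincide at [Goal] and [Sink].
    Iterating [up] gives the unbroken climb from a rung, the transient ray from a goal, and the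
    constant run from a sink. *)
Definition up (s : position) : position :=
  match s with
  | Ladder i => Gamble i | Gamble i => Ladder i.+1 | Exit i => Goal i
  | Goal i => Goal i.+1 | Sink i => Sink i
  end.

Definition down (s : position) : position :=
  match s with
  | Ladder i => Exit i | Gamble _ => Ladder 0 | Exit i => Sink i
  | Goal i => Goal i.+1 | Sink i => Sink i
  end.

Definition move : rel position := [rel s t | (t == up s) || (t == down s)].

Definition ladder (s : position) : bool := if s is Ladder _ then true else false.

Lemma move_up s : move s (up s). Proof. by apply/orP; left. Qed.

Lemma move_down s : move s (down s). Proof. by apply/orP; right. Qed.

Lemma move_total s : exists t, move s t.
Proof. by exists (up s); exact: move_up. Qed.

Section Gambling.
Context (R : realType).

(* The threshold [n] only matters at ladder states, where it encodes the
   decision to exit at the levels [n] and above. *)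
Definition up_prob (n : nat) (s : position) : R :=
  match s with
  | Ladder i => (i < n)%N%:R
  | Gamble _ => 2^-1
  | Exit i => 1 - i.+1%:R^-1
  | _ => 1
  end.

Lemma up_prob01 n s : 0 <= up_prob n s <= 1.
Proof.
case: s => [i|i|i|i|i] /=; rewrite ?lexx ?ler01//.
- by case: ltnP; rewrite ?lexx ?ler01.
- by apply/andP; split; lra.
- by rewrite subr_ge0 gerBl invr_ge0 ler0n invf_le1 ?ltr0n// ler1n.
Qed.

Definition move_prob n s : position -> R := two_point (up_prob n s) (up s) (down s).

Lemma move_prob_distribution n s : distribution_on (move s) (move_prob n s).
Proof. exact: two_point_distribution (up_prob01 n s) (move_up s) (move_down s). Qed.

Definition gambling : mdp R := @MDP R position ladder move move_total (move_prob 0)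
  (fun s _ => move_prob_distribution 0 s).

Lemma gambling_finitely_branching : finitely_branching gambling.
Proof.
move=> s; apply/finite_seqP; exists [:: up s; down s : gambling].
by apply/seteqP; split=> t /=; rewrite !inE.
Qed.

Definition threshold n : strategy gambling :=
  @Strategy R gambling (fun=> move_prob n) (fun _ s _ => move_prob_distribution n s).

Lemma next_prob_threshold n rho (s : gambling) :
  next_prob (threshold n) rho s = move_prob n s.
Proof. by rewrite /next_prob; case: ifP => //; case: s. Qed.

(** * Lower bounds on the probability of transience after a history *)

Section History.
Context (s0 : gambling) (sigma : strategy gambling).
Let mu := Pr s0 sigma.
Let prob (w : seq gambling) : R := word_prob sigma [::] s0 w.

Lemma word_prob_ray rho (s : gambling) n :
  (forall rho k, next_prob sigma rho (iter k up s) (iter k.+1 up s) = 1) ->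
  word_prob sigma rho s (traject up (up s) n) = 1.
Proof.
elim: n rho s => //= n IH rho s h; rewrite (h rho 0%N) mul1r IH// => rho' k.
by rewrite -!iterSr; exact: h.
Qed.

(** Once the [up] moves are forced, lengthening the cylinder costs no probability, and [tail_ge]
    passes to the limit. *)
Lemma ray_prob w :
  (forall rho k, next_prob sigma rho (iter k up (last s0 w))
    (iter k.+1 up (last s0 w)) = 1) ->
  ((prob w)%:E <= mu (tail s0 up w))%E.
Proof.
move=> h; apply: tail_ge => n; rewrite /tail_cylinder.
by rewrite inducedP word_prob_cat word_prob_ray// mulr1.
Qed.

Lemma next_prob_goal rho i : next_prob sigma rho (Goal i : gambling) (Goal i.+1) = 1.
Proof. exact: two_pointxx. Qed.

Lemma next_prob_sink rho i : next_prob sigma rho (Sink i : gambling) (Sink i) = 1.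
Proof. exact: two_pointxx. Qed.

Lemma iter_up_goal i k : iter k up (Goal i) = Goal (k + i).
Proof. by elim: k => //= k ->. Qed.

Lemma iter_up_sink i k : iter k up (Sink i) = Sink i.
Proof. by elim: k => //= k ->. Qed.

(** The conditional probability of transience is at least [x] after every history ending in [s]. The
    product form avoids conditioning on null events. *)
Definition lower_bound (x : R) (s : gambling) := forall w, last s0 w = s ->
  ((x * prob w)%:E <= mu (cylinder (s0 :: w) `&` Transience gambling))%E.

Lemma lower_bound_goal i : lower_bound 1 (Goal i).
Proof.
move=> w lw; rewrite mul1r.
(* A history of positive probability follows transitions, so its continuation along the ray is a
   run. *)
have [->|wP] := eqVneq (prob w) 0; first exact: measure_ge0.
have := @ray_prob w; rewrite lw => /(_ _)/le_trans; apply.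
  by move=> rho k; rewrite !iter_up_goal; exact: next_prob_goal.
apply: le_measure; rewrite ?inE; [exact: measurable_tail| |].
  by apply: measurableI; [exact: measurable_cylinder|exact: measurable_Transience].
move=> r /tailP[rw]; rewrite lw => rk; split=> //.
have rnth k : (k <= size w)%N -> r k = nth s0 (s0 :: w) k.
  by move=> kw; exact: cylinder_nth rw _.
split=> [k|s].
  have [kw|wk] := ltnP k (size w).
    rewrite !rnth ?(ltnW kw)//=.
    by have /(pathP s0) := word_prob_path wP; apply.
  rewrite -(subnKC wk) -addnS !rk iterS; exact: move_up.
(* At time [size w + k] the run is at [Goal (k + i)], whose index is at least [k]; so the index of a
   state bounds the times of its visits. *)
apply/finite_nat_bounded; exists (size w + (position_code s).2).+1 => k /= <-.
have [kw|wk] := ltnP k (size w); first by rewrite ltnS (leq_trans (ltnW kw)) ?leq_addr.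
by rewrite -(subnKC wk) rk iter_up_goal ltnS leq_add2l leq_addr.
Qed.

Lemma lower_bound0 s : lower_bound 0 s.
Proof. by move=> w _; rewrite mul0r; exact: measure_ge0. Qed.

Lemma lower_bound_le x y s : x <= y -> lower_bound y s -> lower_bound x s.
Proof.
move=> xy h w /h; apply: le_trans; rewrite lee_fin ler_wpM2r//.
exact: word_prob_ge0.
Qed.

(** Total probability: appending [up s] or [down s] to the history gives two disjoint events inside
    the original one. *)
Lemma lower_bound_step n x y s : up s != down s ->
  (forall rho, next_prob sigma rho s = move_prob n s) ->
  lower_bound x (up s) -> lower_bound y (down s) ->
  lower_bound (up_prob n s * x + (1 - up_prob n s) * y) s.
Proof.
move=> ud np hx hy w lw.
have pE t : prob (rcons w t) = prob w * move_prob n s t.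
  by rewrite /prob -cats1 word_prob_cat /= lw np mulr1.
pose F t : set (seq_space s0) := cylinder (s0 :: rcons w t) `&` Transience gambling.
have mF t : measurable (F t).
  by apply: measurableI; [exact: measurable_cylinder|exact: measurable_Transience].
apply: (@le_trans _ _ (mu (F (up s)) + mu (F (down s)))%E).
  have -> : (up_prob n s * x + (1 - up_prob n s) * y) * prob w =
      x * prob (rcons w (up s)) + y * prob (rcons w (down s)).
    rewrite !pE /move_prob two_pointl// two_pointr//; ring.
  by rewrite EFinD leeD// ?hx ?hy// last_rcons.
rewrite -measureU//; last first.
  apply/seteqP; split=> // r [[ru _] [rd _]].
  have sz t : (size (s0 :: w) < size (s0 :: rcons w t))%N by rewrite /= size_rcons.
  have := cylinder_nth s0 ru (sz _); rewrite (cylinder_nth s0 rd (sz _))/=.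
  by rewrite !nth_rcons ltnn eqxx => /eqP; rewrite eq_sym (negbTE ud).
apply: le_measure; rewrite ?inE; first exact: measurableU.
  by apply: measurableI; [exact: measurable_cylinder|exact: measurable_Transience].
have sub t : F t `<=` cylinder (s0 :: w) `&` Transience gambling.
  by move=> r []; rewrite -cats1 -cat_cons => /cylinder_cat[].
by move=> r [] /sub.
Qed.
End History.

(** * Threshold strategies and the value *)

Section Threshold.
Context (s0 : gambling) (n : nat).
Let lb := lower_bound s0 (threshold n).
Let c : R := 1 - n.+1%:R^-1.

Let c01 : 0 <= c <= 1. Proof. exact: (up_prob01 n (Exit n)). Qed.

Let stepP := fun x y s =>
  @lower_bound_step s0 _ n x y s^~ (fun rho => next_prob_threshold n rho s).

Lemma lower_bound_high i : (n <= i)%N -> lb c (Ladder i).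
Proof.
move=> ni; have e : lb (1 - i.+1%:R^-1) (Exit i).
  have := stepP (s := Exit i) isT (@lower_bound_goal s0 _ i) (@lower_bound0 s0 _ _).
  by rewrite mulr1 mulr0 addr0.
have := stepP (s := Ladder i) isT (@lower_bound0 s0 _ _) e.
rewrite mulr0 add0r /= ltnNge ni subr0 mul1r; apply: lower_bound_le.
by rewrite lerD2l lerN2 lef_pV2 ?posrE ?ltr0n// ler_nat.
Qed.

(** Here [k] counts the rungs left below [n]: all [k] gambles are won with probability [2^-k], and
    otherwise the play is back at rung 0, where [x] applies. *)
Lemma lower_bound_climb x k i : lb x (Ladder 0) -> (k + i)%N = n ->
  lb (2^-1 ^+ k * c + (1 - 2^-1 ^+ k) * x) (Ladder i).
Proof.
move=> x0; elim: k i => [|k IH] i ni.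
  rewrite expr0 mul1r subrr mul0r addr0; apply: lower_bound_high.
  by rewrite -ni.
have h : lb _ (Ladder i.+1) := IH i.+1 (etrans (addnS _ _) ni).
have g := stepP (s := Gamble i) isT h x0.
have := stepP (s := Ladder i) isT g (@lower_bound0 s0 _ _).
have -> : up_prob n (Ladder i) = 1 by rewrite /= -ni addSn ltnS leq_addl.
by apply: lower_bound_le; rewrite /= exprS; lra.
Qed.

(* The supremum [x] of the bounds at [Ladder 0] satisfies
   [2^-n * c + (1 - 2^-n) * x <= x]. *)
Lemma lower_bound_bottom : lb c (Ladder 0).
Proof.
have [c0 c1] := andP c01.
(* The clause [x <= 1] keeps [X] bounded: if no history ending in [Ladder 0] has positive
   probability, every [x] satisfies [lb]. *)
pose X := [set x : R | x <= 1 /\ lb x (Ladder 0)].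
have X0 : X 0 by split; [exact: ler01|exact: lower_bound0].
have Xub : has_ubound X by exists 1 => x [].
have s1 : sup X <= 1 by apply: ge_sup => [|x []//]; exists 0.
(* For each history of positive probability the condition bounds [x] by a constant, so it passes to
   the supremum. *)
have lbs : lb (sup X) (Ladder 0).
  move=> w lw; set p := word_prob _ _ _ _; set A := _ `&` _.
  have mA : measurable (A : set (seq_space s0)).
    by apply: measurableI; [exact: measurable_cylinder|exact: measurable_Transience].
  have := word_prob_ge0 (threshold n) [::] s0 w; rewrite le_eqVlt => /predU1P[p0|p0].
    by rewrite /p -p0 mulr0; exact: measure_ge0.
  have Afin : (Pr s0 (threshold n) A = (fine (Pr s0 (threshold n) A))%:E)%E.
    by rewrite fineK// fin_num_measure.
  rewrite Afin lee_fin -ler_pdivlMr//; apply: ge_sup; first by exists 0.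
  by move=> x [_ /(_ w lw)]; rewrite -/A Afin lee_fin ler_pdivlMr.
have /andP[q0 q1] : 0 < (2^-1 : R) ^+ n <= 1.
  by rewrite exprn_gt0 ?invr_gt0//= exprn_ile1 ?invr_ge0// invf_le1// ler1n.
have : X (2^-1 ^+ n * c + (1 - 2^-1 ^+ n) * sup X).
  split; first nra.
  by apply: lower_bound_climb => //; rewrite addn0.
move=> /(ub_le_sup Xub); rewrite mulrBl mul1r addrCA gerDl -mulrBr.
by rewrite pmulr_rle0// subr_le0 => cs; exact: lower_bound_le cs lbs.
Qed.

Lemma lower_bound_ladder i : lb c (Ladder i).
Proof.
have [ni|/ltnW ni] := leqP n i; first exact: lower_bound_high.
have := lower_bound_climb lower_bound_bottom (subnK ni).
by rewrite -mulrDl addrC subrK mul1r.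
Qed.
End Threshold.

(** [threshold n] attains at least [1 - 1 / (n + 1)], read off from [lower_bound_ladder] at the
    empty history. *)
Lemma value_ladder (s : gambling) : controlled s -> value (Transience gambling) s = 1%E.
Proof.
case: s => // i _; apply/eqP; rewrite eq_le; apply/andP; split.
  apply: ge_ereal_sup => _ [sigma _ <-]; apply: probability_le1.
  exact: measurable_Transience.
apply/lee_addgt0Pr => e e0; have [n] := ltr_add_invr e0; rewrite add0r => ne.
apply: (@le_trans _ _ ((1 - n.+1%:R^-1)%:E + e%:E)%E).
  by rewrite -EFinD lee_fin -addrA lerDl addrC subr_ge0 ltW.
apply: leeD => //; apply: (@le_trans _ _
  (Pr (Ladder i : gambling) (threshold n) (Transience gambling))).
  have := @lower_bound_ladder (Ladder i) n i [::] erefl; rewrite mulr1.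
  move=> /le_trans; apply; apply: le_measure; rewrite ?inE.
  - by apply: measurableI; [exact: measurable_cylinder|exact: measurable_Transience].
  - exact: measurable_Transience.
  - by move=> r [].
by apply: ereal_sup_ubound; exists (threshold n).
Qed.

(** * No strategy is almost surely transient from rung 0 *)

Section No_optimal.
Context (sigma : strategy gambling).
Let s0 : gambling := Ladder 0.
Let mu := Pr s0 sigma.
Context (mu1 : mu (Transience gambling) = 1%E).
Let prob (w : seq gambling) : R := word_prob sigma [::] s0 w.

(** After [w] the play moves to the absorbing [Sink i] with probability [1 / (i + 1)]. The resulting
    run is not transient, hence null under [mu1], and dividing by this positive factor gives the
    claim. *)
Lemma prob_exit w i : last s0 w = Exit i -> prob w = 0.
Proof.
move=> lw; set v := rcons w (Sink i : gambling).
have lv : last s0 v = Sink i by rewrite last_rcons.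
have null : (mu (tail s0 up v) <= 0)%E.
  apply: (@le_trans _ _ (mu (~` Transience gambling))); last first.
    by rewrite probability_setC ?mu1 ?subee//; exact: measurable_Transience.
  apply: le_measure; rewrite ?inE; first exact: measurable_tail.
    by apply: measurableC; exact: measurable_Transience.
  move=> r /tailP[_]; rewrite lv => rk [_ /(_ (Sink i))/finite_nat_bounded[n nP]].
  have /nP : [set k | r k = Sink i] (size v + n)%N by rewrite /= rk iter_up_sink.
  by rewrite ltnNge leq_addl.
have : ((prob v)%:E <= 0)%E.
  apply: le_trans null; apply: ray_prob => rho k.
  by rewrite lv !iter_up_sink; exact: next_prob_sink.
rewrite lee_fin /prob /v -cats1 word_prob_cat /= lw mulr1.
rewrite [next_prob _ _ _ _]two_pointr//=.
have p0 := word_prob_ge0 sigma [::] s0 w.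
rewrite opprB addrC subrK pmulr_lle0 ?invr_gt0// => ple0.
by apply/eqP; rewrite eq_le ple0.
Qed.

(** A rung takes two moves, hence [k.*2]: the decision to gamble, of probability at most 1, and a
    win, of probability 1/2. *)
Lemma prob_climb rho i k :
  word_prob sigma rho (Ladder i : gambling) (traject up (Gamble i) k.*2) <= 2^-1 ^+ k.
Proof.
elim: k rho i => [|k IH] rho i //.
rewrite doubleS exprS /=.
have [n1 n0] := (next_prob_le1 sigma rho (Ladder i : gambling) (Gamble i),
  next_prob_ge0 sigma rho (Ladder i : gambling) (Gamble i)).
have -> rho' : next_prob sigma rho' (Gamble i : gambling) (Ladder i.+1) = 2^-1.
  exact: two_pointl.
have := IH (rcons (rcons rho (Ladder i)) (Gamble i)) i.+1.
have := word_prob_ge0 sigma (rcons (rcons rho (Ladder i)) (Gamble i))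
  (Ladder i.+1 : gambling) (traject up (Gamble i.+1) k.*2).
set p := word_prob _ _ _ _; nra.
Qed.

Lemma tail_climb w : last s0 w = s0 -> mu (tail s0 up w) = 0%E.
Proof.
move=> lw; apply/eqP; rewrite eq_le measure_ge0 andbT.
apply/lee_addgt0Pr => e e0; rewrite add0e.
have [k ke] : exists k, 2^-1 ^+ k < e :> R.
  exists (Num.bound e^-1); rewrite exprVn invf_plt ?posrE ?exprn_gt0//.
  exact: upper_nthrootP.
apply: (@le_trans _ _ (mu (tail_cylinder s0 up w k.*2))).
  apply: le_measure; rewrite ?inE; [exact: measurable_tail|exact: measurable_cylinder|].
  by move=> r; apply.
rewrite inducedP lee_fin word_prob_cat lw; apply: le_trans (ltW ke).
apply: le_trans (prob_climb ([::] ++ belast s0 w) 0 k).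
by rewrite ler_piMl ?word_prob_ge0 ?word_prob_le1.
Qed.

(** Two kinds of null events, indexed by the countably many histories: [w] arrives at an exit, or
    [w] ends at rung 0 and the run climbs forever afterwards. *)
Definition losing (w : seq gambling) : set (seq_space s0) :=
  match (last s0 w : position) with
  | Exit _ => cylinder (s0 :: w)
  | Ladder 0 => tail s0 up w
  | _ => set0
  end.

Lemma losing_null w : mu.-negligible (losing w).
Proof.
rewrite /losing; case E : (last s0 w : position) => [[|i]|i|i|i|i];
  try exact: negligible_set0.
  by apply/negligibleP; [exact: measurable_tail|exact: tail_climb].
apply/negligibleP; first exact: measurable_cylinder.
by apply: etrans (inducedP s0 sigma w) _; rewrite [word_prob _ _ _ _](prob_exit E).
Qed.

(** Without an exit, a transient run has a last visit to rung 0 and can only climb after it.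
    Sequences not starting in [s0] appear because the measure lives on all sequences. *)
Lemma Transience_losing : (Transience gambling : set (seq_space s0)) `<=`
  ~` cylinder [:: s0] `|` \bigcup_w losing w.
Proof.
move=> r [rr ft]; have [r0|nr0] := eqVneq (r 0%N) s0; last first.
  by left; rewrite /cylinder /= /mkseq /= => -[]; apply/eqP.
pose w k := behead (mkseq r k.+1).
have wE k : s0 :: w k = mkseq r k.+1 by rewrite /w /mkseq /= r0.
have sw k : size (w k) = k by rewrite /w /mkseq /= size_map size_iota.
have lwE k : last s0 (w k) = r k.
  by rewrite (last_nth s0) wE sw nth_mkseq.
have cw k : cylinder (s0 :: w k) r by rewrite wE /cylinder /= size_map size_iota.
right; have [[k [i ri]]|noexit] := pselect (exists k i, r k = Exit i).
  by exists (w k) => //; rewrite /losing lwE ri; exact: cw.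
have /finite_nat_bounded[n nP] := ft s0.
have exK : exists k, (r k == s0) && (k < n)%N.
  by exists 0%N; rewrite r0 eqxx nP.
have ubK k : (r k == s0) && (k < n)%N -> (k <= n)%N by move=> /andP[_ /ltnW].
(* [K] is the time of the last visit to rung 0; transience bounds these times by [n]. *)
have [K /andP[/eqP rK _] Kmax] := ex_maxnP exK ubK.
have after k : r (K + k)%N = s0 -> k = 0%N.
  move=> rk; have := Kmax (K + k)%N; rewrite rk eqxx nP//= => /(_ isT).
  by rewrite -[X in (_ <= X)%N]addn0 leq_add2l leqn0 => /eqP.
exists (w K) => //; rewrite /losing lwE rK; apply/tailP; split=> //.
rewrite lwE rK sw.
(* The induction also carries that the play is on the ladder: then the only alternatives to [up] are
   an exit, excluded by [noexit], and a fall to rung 0, excluded by the choice of [K]. *)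
suff h k : (exists i, r (K + k)%N = Ladder i \/ r (K + k)%N = Gamble i) /\
    r (K + k)%N = iter k up s0 by move=> k; case: (h k).
elim: k => [|k [[i ri] e]]; first by rewrite addn0 rK; split=> //; exists 0%N; left.
have := rr (K + k)%N; rewrite -addnS iterS -e.
case: ri => rik; rewrite rik => /orP[/eqP|/eqP] rS.
- by rewrite rS; split=> //; exists i; right.
- by exfalso; apply: noexit; exists (K + k.+1)%N, i.
- by rewrite rS; split=> //; exists i.+1; left.
- by have := after k.+1 rS.
Qed.

Lemma no_sure_transience : False.
Proof.
have : mu.-negligible (Transience gambling : set (seq_space s0)).
  apply: negligibleS Transience_losing _; apply: negligibleU.
    apply/negligibleP; first by apply: measurableC; exact: measurable_cylinder.
    apply: etrans (probability_setC _ (measurable_cylinder _)) _.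
    by rewrite [X in (_ - X)%E](inducedP s0 sigma [::]) subee.
  rewrite bigcup_unpickle; apply: negligible_bigcup => n.
  by case: unpickle => [w|] /=; [exact: losing_null|exact: negligible_set0].
move/measure_negligible => /(_ (@measurable_Transience _ _ s0)) mu0.
by have /eqP := etrans (esym mu1) mu0; rewrite onee_eq0.
Qed.
End No_optimal.
End Gambling.

Theorem lemma1 (R : realType) :
  exists (M : mdp R) (s0 : M),
    [/\ finitely_branching M,
        forall s : M, controlled s -> value (Transience M) s = 1%E,
        value (Transience M) s0 = 1%E,
        ~ (exists sigma : strategy M, optimal (Transience M) s0 sigma)
      & ~ (exists sigma : strategy M, Pr s0 sigma (Transience M) = 1%E)].
Proof.
have nosure : ~ exists sigma : strategy (gambling R),
    Pr (Ladder 0 : gambling R) sigma (Transience (gambling R)) = 1%E.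
  by case=> sigma; exact: no_sure_transience.
exists (gambling R), (Ladder 0); split=> //.
- exact: gambling_finitely_branching.
- exact: value_ladder.
- exact: value_ladder.
- by case=> sigma opt; apply: nosure; exists sigma; rewrite opt value_ladder.
Qed.
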